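(* Let $q$ be a prime power and $n\geq 2$ an integer. Let $W$ and $Y=\{\gamma_j:0\leq j\leq n-1\}$ be any two bases for $\mathbb{F}_{q^n}$ over $\mathbb{F}_q$. Let $B=\{\beta_j:0\leq j\leq n-1\}$ be the dual basis of $W$. Let $\overline{g}=(g_0:\dots:g_{n-1})$ be any bijection over $\mathrm{PG}(n-1,q)$, where $g_0,\dots,g_{n-1}:\mathbb{F}_q^n\to\mathbb{F}_q$ are multivariate polynomials. Let $r\in\mathbb{N}$ be coprime to $q-1$. For $0\leq j\leq n-1$ and each $x\in\mathbb{F}_{q^n}^\ast$ such that $j=\max\{0\leq i\leq n-1:\mathrm{Tr}_q^{q^n}(\beta_ix)\neq 0\}$, define $$f_j(x)=\mathrm{Tr}_q^{q^n}(\beta_jx)^r\sum_{k=0}^{n-1}g_k\Biggl(\frac{\mathrm{Tr}_q^{q^n}(\beta_0x)}{\mathrm{Tr}_q^{q^n}(\beta_jx)},\dots,\frac{\mathrm{Tr}_q^{q^n}(\beta_{j-1}x)}{\mathrm{Tr}_q^{q^n}(\beta_jx)},1,0,\dots,0\Biggr)\gamma_k.$$ Then $f:\mathbb{F}_{q^n}\to\mathbb{F}_{q^n}$, where $$f(x)=\begin{cases}0&\text{if }x=0;\\ f_j(x)&\text{if }j=\max\{0\leq i\leq n-1:\mathrm{Tr}_q^{q^n}(\beta_ix)\neq 0\}\quad(0\leq j\leq n-1),\end{cases}$$ is a rational mapping permuting $\mathbb{F}_{q^n}$. In particular, if $r\geq\max\{\deg(g_k):0\leq k\leq n-1\}$,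 then $f$ is a permutation polynomial of index $\frac{q^n-1}{q-1}$ over $\mathbb{F}_{q^n}$.
   Context: $\mathrm{PG}(n-1,q)=(\mathbb{F}_q^n\setminus\{\vec 0\})/\sim$, where $\vec x\sim\vec y$ iff $\vec x=\lambda\vec y$ for some $\lambda\in\mathbb{F}_q^\ast$; the class of $(x_0,\dots,x_{n-1})$ is written $(x_0:\dots:x_{n-1})$. The map $\overline g$ sends $(x_0:\dots:x_{n-1})$ to $(g_0(x_0,\dots,x_{n-1}):\dots:g_{n-1}(x_0,\dots,x_{n-1}))$; in particular it is assumed to be well defined (the $g_k$ have no common zero in $\mathbb{F}_q^n\setminus\{\vec 0\}$, and proportional nonzero inputs have proportional outputs). $\mathrm{Tr}_q^{q^n}$ is the trace from $\mathbb{F}_{q^n}$ to $\mathbb{F}_q$. The dual basis of $W=\{\omega_j\}$ is the basis with $\mathrm{Tr}_q^{q^n}(\beta_i\omega_j)=1$ if $i=j$ and $0$ otherwise. A map ''permutes'' a set if it is a bijection of the set to itself. ''Rational mapping'' means given piecewise, on the sets where $\max\{i:\mathrm{Tr}_q^{q^n}(\beta_ix)\neq 0\}=j$, by rational expressions in $x$. A permutation polynomial (here with the given $r$) of index $\frac{q^n-1}{q-1}$ over $\mathbb{F}_{q^n}$ means a permutation of $\mathbb{F}_{q^n}$ of the form $f(x)=x^rh(x^{q-1})$ for all $x\in\mathbb{F}_{q^n}$, with $h\in\mathbb{F}_{q^n}[x]$. *)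

(* Defs.v *)
(* Mathematical Components, with the Multinomials library for {mpoly F[n]}. *)
From HB Require Import structures.
From mathcomp Require Import all_boot all_order all_fingroup all_algebra.
From mathcomp Require Import all_solvable all_field.
From mathcomp Require Import mpoly.

Set Implicit Arguments.
Unset Strict Implicit.
Unset Printing Implicit Defensive.

Import GRing.Theory.
Local Open Scope ring_scope.
Local Open Scope quotient_scope.

Section ProjectiveSpace.

Variables (F : finFieldType) (n : nat).

Definition nzvec : Type := {v : 'rV[F]_n | v != 0}.

Definition proportional (u v : nzvec) : bool :=
  [exists c : F, (c != 0) && (val u == c *: val v)].

Fact proportional_refl : reflexive proportional.
Proof.
by move=> u; apply/existsP; exists 1; rewrite oner_neq0 scale1r eqxx.
Qed.

Fact proportional_sym : ssrbool.symmetric proportional.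
Proof.
have sub u v : proportional u v -> proportional v u.
  case/existsP=> c /andP[c0 /eqP e]; apply/existsP; exists c^-1.
  by rewrite invr_eq0 c0 e scalerA mulVf // scale1r eqxx.
by move=> u v; apply/idP/idP; apply: sub.
Qed.

Fact proportional_trans : transitive proportional.
Proof.
move=> v u w /existsP[c /andP[c0 /eqP e]] /existsP[d /andP[d0 /eqP e']].
apply/existsP; exists (c * d).
by rewrite mulf_neq0 //= e e' scalerA eqxx.
Qed.

Canonical proportional_equiv : equiv_rel nzvec :=
  EquivRel proportional proportional_refl proportional_sym proportional_trans.

(* PG n is PG(n-1, q) for q = #|F|: n counts homogeneous coordinates. *)
Definition PG : Type := {eq_quot proportional_equiv}.

Definition evalv (g : 'I_n -> {mpoly F[n]}) (v : 'rV[F]_n) : 'rV[F]_n :=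
  \row_k (g k).@[v 0].

(* Existence of gbar with this property says exactly that the g k have no
   common zero outside 0 and send proportional vectors to proportional ones. *)
Definition induces (g : 'I_n -> {mpoly F[n]}) (gbar : PG -> PG) : Prop :=
  forall v : nzvec,
    exists2 w : nzvec, val w = evalv g (val v) & gbar (\pi v) = \pi w.

End ProjectiveSpace.

Section FieldExtension.

Variables (F : finFieldType) (L : splittingFieldType F).

(* galTrace takes its values in L; trF x is the corresponding element of F.
   By trFE below, the default 0 is never used. *)
Definition trF (x : L) : F :=
  odflt 0 [pick a : F | a%:A == galTrace 1 {:L} x].

Fact trFE (x : L) : (trF x)%:A = galTrace 1 {:L} x.
Proof.
rewrite /trF; case: pickP => [a /eqP // | no].
have /vlineP[a Da] : galTrace 1 {:L} x \in 1%VS.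
  by apply: mem_galTrace (memvf x); apply/finField_galois/sub1v.
by have := no a; rewrite Da eqxx.
Qed.

Definition dual_basis n (W B : n.-tuple L) : Prop :=
  basis_of {:L} B /\
  forall i j : 'I_n, trF (tnth B i * tnth W j) = (i == j)%:R.

(* Meaningful for x != 0 only: at x = 0 the maximum is over the empty set and
   has the junk value 0. *)
Definition top_index n (B : n.-tuple L) (x : L) : nat :=
  \max_(i < n | trF (tnth B i * x) != 0) i.

Definition f_piece n (B Y : n.-tuple L) (g : 'I_n -> {mpoly F[n]}) (r j : nat)
    (x : L) : L :=
  let t := trF (B`_j * x) in
  t ^+ r *:
    \sum_(k < n) (g k).@[fun i : 'I_n => if (i < j)%N then trF (tnth B i * x) / t
                                         else (i == j :> nat)%:R] *: tnth Y k.

Definition f_map n (B Y : n.-tuple L) (g : 'I_n -> {mpoly F[n]}) (r : nat)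
    (x : L) : L :=
  if x == 0 then 0 else f_piece B Y g r (top_index B x) x.

(* Denominators are required not to vanish on the relevant piece, so that the
   convention 0^-1 = 0 plays no role. *)
Definition rational_mapping n (B : n.-tuple L) (f : L -> L) : Prop :=
  f 0 = 0 /\
  forall j : 'I_n, exists P Q : {poly L}, forall x : L,
    x != 0 -> top_index B x = j -> Q.[x] != 0 /\ f x = P.[x] / Q.[x].

(* With q = #|F| and q ^ n = #|L|, the index (q ^ n - 1) / (q - 1) corresponds
   to the exponent q - 1 inside h. *)
Definition index_permutation_polynomial (r : nat) (f : L -> L) : Prop :=
  bijective f /\
  exists h : {poly L}, forall x : L, f x = x ^+ r * h.[x ^+ (#|F| - 1)].

End FieldExtension.

(* Main.v *)
(** Relative to the dual bases [W] and [B] the traces [trF (tnth B i * x)] are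
    the coordinates of [x] on [W].  If [t] is the last nonzero coordinate of the
    coordinate vector [v], then [f x] is the vector [t ^+ r *: g (t^-1 *: v)] read
    on the basis [Y].  Here [t^-1 *: v] is a normalised representative of the
    projective point of [v], so [f x] determines this point because [gbar] is
    injective, hence it determines [g (t^-1 *: v)], then [t ^+ r], and then [t]
    since [r] is coprime to [#|F| - 1].  As [L] is finite, [f] is bijective.
    Moreover [f (c *: x) = c ^+ r *: f x] for [c] in [F], so that [f x / x ^+ r]
    only depends on [x ^+ (#|F| - 1)]; every function on a finite field being
    polynomial, this quotient is [h] evaluated at that power. *)
Require Import Defs.
From mathcomp Require Import all_boot all_order all_fingroup all_algebra.
From mathcomp Require Import all_solvable all_field.
From mathcomp Require Import mpoly.
Set Implicit Arguments.
Unset Strict Implicit.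
Unset Printing Implicit Defensive.
Import GRing.Theory.
Local Open Scope ring_scope.

(** * Interpolation and power maps on finite fields *)

Lemma fin_interpolation (K : finFieldType) (phi : K -> K) :
  exists P : {poly K}, forall x, P.[x] = phi x.
Proof.
(* The unnormalised Lagrange polynomials: [R a] vanishes at every point except [a]. *)
pose R a : {poly K} := \prod_(b | b != a) ('X - b%:P).
have Ra a : (R a).[a] != 0.
  rewrite horner_prod; apply/prodf_neq0 => b ba.
  by rewrite hornerXsubC subr_eq0 eq_sym.
have Rb a x : x != a -> (R a).[x] = 0.
  by move=> xa; rewrite horner_prod (bigD1 x) //= !hornerE subrr mul0r.
exists (\sum_a (phi a / (R a).[a]) *: R a) => x.
rewrite horner_sum (bigD1 x) //= hornerZ divfK // big1 ?addr0 // => a ax.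
by rewrite hornerZ (Rb a x) ?mulr0 1?eq_sym.
Qed.

(** The order of [s / t] divides both [r] and [#|K| - 1], hence is 1. *)
Lemma expf_coprime_inj (K : finFieldType) (r : nat) (s t : K) :
  coprime r (#|K| - 1) -> s != 0 -> t != 0 -> s ^+ r = t ^+ r -> s = t.
Proof.
move=> co s0 t0 e; apply: (divIf t0); rewrite divff //.
set u := s / t; have u0 : u != 0 by rewrite mulf_neq0 ?invr_eq0.
have u1 : u ^+ r = 1 by rewrite expr_div_n e divff ?expf_neq0.
have uq : u ^+ (#|K| - 1) = 1.
  apply: (mulfI u0); rewrite mulr1 -exprS subn1 prednK ?expf_card //.
  exact: ltnW (finNzRing_gt1 K).
have q0 : (0 < #|K| - 1)%N by rewrite subn_gt0 finNzRing_gt1.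
(* Bezout in natural numbers: [#|K| - 1] divides [1 + a * r]. *)
have [a _] := Bezoutl r q0; rewrite gcdnC (eqP co) => /dvdnP[m e1].
have : u ^+ (1 + a * r) = 1 by rewrite e1 mulnC exprM uq expr1n.
by rewrite exprD expr1 mulnC exprM u1 expr1n mulr1.
Qed.

(** * The last nonzero entry of a vector *)

Section LastNonzero.

Variables (F : finFieldType) (n : nat).
Implicit Types (u v : 'rV[F]_n) (j k : 'I_n).

Definition last_nonzero v j : Prop :=
  v 0 j != 0 /\ forall i : 'I_n, (j < i)%N -> v 0 i = 0.

Lemma last_nonzeroZ c v j :
  c != 0 -> last_nonzero v j -> last_nonzero (c *: v) j.
Proof.
move=> c0 [vj vi]; split=> [|i ji]; first by rewrite mxE mulf_neq0.
by rewrite mxE vi // mulr0.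
Qed.

Lemma last_nonzero_inj v j k : last_nonzero v j -> last_nonzero v k -> j = k.
Proof.
move=> [vj hj] [vk hk]; apply: val_inj.
case: (ltngtP j k) => // [/hj|/hk] e; first by rewrite e eqxx in vk.
by rewrite e eqxx in vj.
Qed.

Lemma last_nonzero_neq0 v j : last_nonzero v j -> v != 0.
Proof. by case=> vj _; apply: contraNneq vj => ->; rewrite mxE. Qed.

(** Links [last_nonzero] to the maximum in [top_index]; for [v != 0] that maximum ranges over a
    nonempty set, so it is attained. *)
Lemma last_nonzero_max v :
  v != 0 -> exists2 j, last_nonzero v j & (\max_(i < n | v 0%R i != 0%R) i)%N = j.
Proof.
move=> v0.
have /(eq_bigmax_cond (fun i : 'I_n => i : nat)) : (0 < #|[pred i | v 0%R i != 0%R]|)%N.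
  rewrite lt0n; apply: contraNneq v0 => /card0_eq e.
  apply/eqP/rowP => i; rewrite mxE.
  by have := e i; rewrite !inE => /negbFE/eqP.
case=> j; rewrite inE => vj e; exists j => //; split=> // i ji.
apply: contraTeq ji => vi; rewrite -leqNgt -e.
exact: (@leq_bigmax_cond _ (fun i => v 0 i != 0) (fun i : 'I_n => i : nat) i vi).
Qed.

End LastNonzero.

(** * Coordinates given by traces and by bases *)

Section TraceCoordinates.

Variables (F : finFieldType) (L : splittingFieldType F) (n : nat).
Implicit Types (W B Y : n.-tuple L) (x y : L) (c : F) (v : 'rV[F]_n).

(** Checked after embedding [F] in [L], where the trace is a sum of [F]-linear Galois
    automorphisms. *)
Lemma trF_linear c x y : trF (c *: x + y) = c * trF x + trF y.
Proof.
apply: (fmorph_inj (in_alg L)); rewrite rmorphD rmorphM /= !trFE.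
rewrite /galTrace mulr_algl scaler_sumr -big_split /=.
by apply: eq_bigr => s _; rewrite linearP.
Qed.

Lemma trF0 : trF (0 : L) = 0.
Proof.
by have := trF_linear (-1) 0 0; rewrite scaler0 addr0 mulN1r addNr.
Qed.

Lemma trFZ c x : trF (c *: x) = c * trF x.
Proof. by rewrite -[_ *: x]addr0 trF_linear trF0 addr0. Qed.

Lemma trF_sum (I : finType) (E : I -> L) : trF (\sum_i E i) = \sum_i trF (E i).
Proof.
by apply: (big_morph _ _ trF0) => x y; rewrite -[x]scale1r trF_linear mul1r scale1r.
Qed.

Definition tr_coords B x : 'rV[F]_n := \row_i trF (tnth B i * x).

Definition of_coords Y v : L := \sum_(k < n) v 0 k *: tnth Y k.

Lemma tr_coordsZ B c x : tr_coords B (c *: x) = c *: tr_coords B x.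
Proof. by apply/rowP => i; rewrite !mxE -scalerAr trFZ. Qed.

Lemma tr_coords0 B : tr_coords B 0 = 0.
Proof. by apply/rowP => i; rewrite !mxE mulr0 trF0. Qed.

Lemma tr_coords_inj W B :
  basis_of {:L} W -> dual_basis W B -> injective (tr_coords B).
Proof.
move=> hW [_ dual].
(* Expanding [x] on [W], duality leaves only the [i]-th term of the [i]-th trace. *)
suff e x : tr_coords B x = \row_i coord W i x.
  move=> x y; rewrite !e => /rowP exy.
  rewrite (coord_basis hW (memvf x)) (coord_basis hW (memvf y)).
  by apply: eq_bigr => i _; have := exy i; rewrite !mxE => ->.
apply/rowP => i; rewrite !mxE {1}(coord_basis hW (memvf x)) mulr_sumr trF_sum.
rewrite (bigD1 i) //= -scalerAr trFZ -tnth_nth dual eqxx mulr1 big1 ?addr0 // => j ji.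
by rewrite -scalerAr trFZ -tnth_nth dual eq_sym (negPf ji) mulr0.
Qed.

Lemma of_coordsZ Y c v : of_coords Y (c *: v) = c *: of_coords Y v.
Proof.
by rewrite /of_coords scaler_sumr; apply: eq_bigr => k _; rewrite mxE scalerA.
Qed.

Lemma of_coords0 Y : of_coords Y 0 = 0.
Proof. by rewrite -(scale0r 0) of_coordsZ scale0r. Qed.

Lemma of_coords_inj Y : basis_of {:L} Y -> injective (of_coords Y).
Proof.
move=> hY u v e; apply/rowP => i.
have c w : coord Y i (of_coords Y w) = w 0 i.
  rewrite /of_coords.
  under eq_bigr do rewrite (tnth_nth 0).
  by rewrite coord_sum_free ?(basis_free hY).
by rewrite -!c e.
Qed.

End TraceCoordinates.

(** * Coordinate form, homogeneity and injectivity of the map *)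

Section Map.

Variables (F : finFieldType) (L : splittingFieldType F) (n : nat).
Variables (W Y B : n.-tuple L) (g : 'I_n -> {mpoly F[n]}) (r : nat).
Hypotheses (hW : basis_of {:L} W) (hY : basis_of {:L} Y) (hB : dual_basis W B).
Local Notation tc := (tr_coords B).
Local Notation f := (f_map B Y g r).

Lemma tr_coords_eq0 x : (tc x == 0) = (x == 0).
Proof. by rewrite -(tr_coords0 B) (inj_eq (tr_coords_inj hW hB)). Qed.

Lemma last_nonzero_tr_coords x : x != 0 -> exists j, last_nonzero (tc x) j.
Proof. by rewrite -tr_coords_eq0 => /last_nonzero_max[j lj _]; exists j. Qed.

Lemma f_mapE x j : last_nonzero (tc x) j ->
  f x = tc x 0 j ^+ r *: of_coords Y (evalv g ((tc x 0 j)^-1 *: tc x)).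
Proof.
move=> lj; have x0 : x != 0 by rewrite -tr_coords_eq0 (last_nonzero_neq0 lj).
have [k lk topk] : exists2 k, last_nonzero (tc x) k & top_index B x = k.
  have [k lk e] := last_nonzero_max (last_nonzero_neq0 lj).
  by exists k => //; rewrite -e; apply: eq_bigl => i; rewrite mxE.
have {k lk topk} topj : top_index B x = j by rewrite topk (last_nonzero_inj lj lk).
have [vj vi] := lj; rewrite /f_map (negPf x0) topj /f_piece.
have -> : trF (B`_j * x) = tc x 0 j by rewrite mxE (tnth_nth 0).
congr (_ *: _); apply: eq_bigr => k _; rewrite [evalv _ _ _ _]mxE; congr (_ *: _).
apply: meval_eq => i; rewrite [RHS]mxE [RHS]mulrC.
(* Before, after and at [j], the normalised vector has the entries that [f_piece] substitutes: a
   quotient of traces, 0 and 1. *)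
have [ij|ji|/val_inj ->] := ltngtP i j; first by rewrite [tc x 0 i]mxE.
- by rewrite (vi i ji) mul0r.
- by rewrite divff.
Qed.

Lemma f_map0 : f 0 = 0.
Proof. by rewrite /f_map eqxx. Qed.

(** Scaling by [c] keeps the last nonzero index and the normalised vector; only the factor [t ^+ r]
    changes. *)
Lemma f_mapZ c x : c != 0 -> f (c *: x) = c ^+ r *: f x.
Proof.
move=> c0; have [->|x0] := eqVneq x 0; first by rewrite scaler0 f_map0 scaler0.
have [j lj] := last_nonzero_tr_coords x0.
have := last_nonzeroZ c0 lj; rewrite -tr_coordsZ => lcj.
rewrite (f_mapE lj) (f_mapE lcj) tr_coordsZ !mxE exprMn scalerA invfM scalerA.
by rewrite mulrAC mulVf // mul1r.
Qed.

Section Injectivity.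

Variable gbar : PG F n -> PG F n.
Hypotheses (hg : induces g gbar) (gbar_inj : injective gbar).
Hypothesis hr : coprime r (#|F| - 1).

Lemma evalv_neq0 (v : 'rV[F]_n) : v != 0 -> evalv g v != 0.
Proof. by move=> v0; have [[w w0] /= <- _] := hg (exist _ v v0). Qed.

Lemma evalv_projective_inj (u v : 'rV[F]_n) (c : F) :
    u != 0 -> v != 0 -> c != 0 -> evalv g u = c *: evalv g v ->
  exists2 d : F, d != 0 & u = d *: v.
Proof.
move=> u0 v0 c0 e.
pose u' : nzvec F n := exist _ u u0; pose v' : nzvec F n := exist _ v v0.
have [w ew gw] := hg u'; have [w' ew' gw'] := hg v'.
have ww' : proportional w w' by apply/existsP; exists c; rewrite c0 ew ew' e eqxx.
have /gbar_inj/eqquotP/existsP[d /andP[d0 /eqP /= ->]] :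
    gbar (\pi u')%qT = gbar (\pi v')%qT.
  by rewrite gw gw'; apply/eqquotP.
by exists d.
Qed.

Lemma f_map_eq0 x : (f x == 0) = (x == 0).
Proof.
apply/idP/idP => [|/eqP ->]; last by rewrite f_map0.
apply: contraTT => x0; have [j lj] := last_nonzero_tr_coords x0.
have [tj _] := lj.
rewrite (f_mapE lj) scaler_eq0 expf_eq0 (negPf tj) andbF /=.
rewrite -(of_coords0 Y) (inj_eq (of_coords_inj hY)) evalv_neq0 //.
by rewrite scaler_eq0 invr_eq0 (negPf tj) tr_coords_eq0.
Qed.

Lemma f_map_inj : injective f.
Proof.
move=> x y; have [->|x0] := eqVneq x 0.
  by rewrite f_map0 => /esym/eqP; rewrite f_map_eq0 => /eqP.
have [->|y0 exy] := eqVneq y 0.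
  by rewrite f_map0 => /eqP; rewrite f_map_eq0 => /eqP.
have [j lj] := last_nonzero_tr_coords x0; have [k lk] := last_nonzero_tr_coords y0.
have [[tj _] [tk _]] := (lj, lk).
move: exy; rewrite (f_mapE lj) (f_mapE lk).
set s := tc x 0 j in tj *; set t := tc y 0 k in tk *.
set u := s^-1 *: tc x; set v := t^-1 *: tc y => e.
have lu : last_nonzero u j by apply: last_nonzeroZ; rewrite ?invr_eq0.
have lv : last_nonzero v k by apply: last_nonzeroZ; rewrite ?invr_eq0.
have euv : s ^+ r *: evalv g u = t ^+ r *: evalv g v.
  by apply: (of_coords_inj hY); rewrite !of_coordsZ.
have [d d0 eud] : exists2 d : F, d != 0 & u = d *: v.
  apply: (@evalv_projective_inj _ _ (s ^- r * t ^+ r));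
    rewrite ?(last_nonzero_neq0 lu) ?(last_nonzero_neq0 lv) //.
    by rewrite mulf_neq0 ?invr_eq0 ?expf_neq0.
  by rewrite -scalerA -euv scalerA mulVf ?scale1r ?expf_neq0.
have ejk : j = k by apply: last_nonzero_inj lu _; rewrite eud; apply: last_nonzeroZ.
(* Both representatives have entry 1 at their common last index, which forces [d = 1]. *)
have u1 : u 0 j = 1 by rewrite mxE; apply: mulVf.
have v1 : v 0 j = 1 by rewrite ejk mxE; apply: mulVf.
have d1 : d = 1 by rewrite -u1 eud mxE v1 mulr1.
have uv : u = v by rewrite eud d1 scale1r.
(* With [u = v], the nonzero vector [evalv g v] cancels from [euv], leaving [s ^+ r = t ^+ r]. *)
have est : s = t.
  apply: (expf_coprime_inj hr) => //; apply/eqP; rewrite -subr_eq0.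
  have /negPf gv0 := evalv_neq0 (last_nonzero_neq0 lv).
  by move/eqP: euv; rewrite uv -subr_eq0 -scalerBl scaler_eq0 gv0 orbF.
apply: (tr_coords_inj hW hB).
have -> : tc x = s *: u by rewrite scalerA divff // scale1r.
by rewrite uv est scalerA divff // scale1r.
Qed.

End Injectivity.

End Map.

(** * Polynomial form of homogeneous functions, and the conclusion *)

Lemma ext_interpolation (F : finFieldType) (L : splittingFieldType F) (phi : L -> L) :
  exists P : {poly L}, forall x, P.[x] = phi x.
Proof. exact: (@fin_interpolation (FinFieldExtType L)). Qed.

(** The quotient [x / y] is fixed by the Frobenius power [z ^+ #|F|], so it lies in [F]. *)
Lemma expf_card1_eq (F : finFieldType) (L : splittingFieldType F) (x y : L) :
    x != 0 -> y != 0 -> x ^+ (#|F| - 1) = y ^+ (#|F| - 1) ->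
  exists2 c : F, c != 0 & x = c *: y.
Proof.
move=> x0 y0 e; pose z := x / y.
have z0 : z != 0 by rewrite mulf_neq0 ?invr_eq0.
have /vlineP[c zc] : z \in 1%VS.
  rewrite (@Fermat's_little_theorem F L 1%AS) dimv1 expn1.
  rewrite -(subnK (ltnW (finNzRing_gt1 F))) exprD expr1.
  by rewrite expr_div_n e divff ?mul1r ?expf_neq0.
exists c; first by apply: contraNneq z0 => c0; rewrite zc c0 scale0r.
by rewrite -mulr_algl -zc divfK.
Qed.

Lemma homogeneous_index_form (F : finFieldType) (L : splittingFieldType F)
    (r : nat) (f : L -> L) :
    f 0 = 0 -> (forall (c : F) x, c != 0 -> f (c *: x) = c ^+ r *: f x) ->
  exists h : {poly L}, forall x, f x = x ^+ r * h.[x ^+ (#|F| - 1)].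
Proof.
move=> f0 fZ; pose K := FinFieldExtType L.
(* An arbitrary root of exponent [#|F| - 1]. Two nonzero roots of the same element differ by a
   factor in [F], which leaves [f x / x ^+ r] unchanged. The default 0 occurs only at elements that
   are not such powers. *)
pose root_of (y : L) : L := odflt 0 [pick x : K | (x : L) ^+ (#|F| - 1) == y].
have [h hE] := ext_interpolation (fun y => f (root_of y) / root_of y ^+ r).
exists h => x; rewrite hE.
have : root_of (x ^+ (#|F| - 1)) ^+ (#|F| - 1) = x ^+ (#|F| - 1).
  rewrite /root_of; case: pickP => [z /eqP // | /(_ x)]; by rewrite eqxx.
have q0 : (0 < #|F| - 1)%N by rewrite subn_gt0 finNzRing_gt1.
set y := root_of _ => e; have [x0|x0] := eqVneq x 0.
  have /eqP : y ^+ (#|F| - 1) = 0 by rewrite e x0 expr0n eqn0Ngt q0.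
  by rewrite expf_eq0 q0 /= => /eqP ->; rewrite x0 f0 mul0r mulr0.
have y0 : y != 0.
  have : y ^+ (#|F| - 1) != 0 by rewrite e expf_neq0.
  by rewrite expf_eq0 q0.
have [c c0 ->] := expf_card1_eq x0 y0 (esym e).
by rewrite fZ // exprZn -scalerAl mulrCA divff ?mulr1 ?expf_neq0.
Qed.

Theorem mainTheorem3 (F : finFieldType) (L : splittingFieldType F) (n : nat)
    (hn : (2 <= n)%N) (hL : \dim {:L} = n)
    (W Y B : n.-tuple L)
    (hW : basis_of {:L} W) (hY : basis_of {:L} Y) (hB : dual_basis W B)
    (g : 'I_n -> {mpoly F[n]}) (gbar : PG F n -> PG F n)
    (hg : induces g gbar) (hgbar : bijective gbar)
    (r : nat) (hr : coprime r (#|F| - 1)) :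
  [/\ rational_mapping B (f_map B Y g r),
      bijective (f_map B Y g r)
    & (\max_(k < n) (msize (g k)).-1 <= r)%N ->
      index_permutation_polynomial r (f_map B Y g r)].
Proof.
have f_bij : bijective (f_map B Y g r).
  apply: (@injF_bij (FinFieldExtType L)).
  exact: (f_map_inj hW hY hB hg (bij_inj hgbar) hr).
split=> // [|_].
- split=> [|j]; first exact: f_map0.
  have [P hP] := ext_interpolation (f_map B Y g r).
  (* One polynomial interpolates the whole map, so it serves every piece with denominator 1. *)
  exists P, 1 => x _ _; rewrite hornerC hP divr1; split=> //; exact: oner_neq0.
- split=> //; apply: homogeneous_index_form; first exact: f_map0.
  by move=> c x; apply: (f_mapZ Y g r hW hB).
Qed.
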